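(* Let $\Sigma=\langle S,F,R,\mathrm{Ax}\rangle$ be a $\lambda$-signature and $T$ a $\lambda$-theory over $\Sigma$ (a set of equalities-in-context). A $\lambda$-type $A$ is a logical consequence of the $\lambda$-types $B_1,\dots,B_n$ if and only if there is a proof of $A$ from the hypotheses $B_1,\dots,B_n$ in first-order intuitionistic logic with axioms the formulae corresponding to the symbols in $\mathrm{Ax}$, when $\lambda$-types are interpreted as logical formulae and $\lambda$-terms as logical proofs according to the Curry–Howard isomorphism.
   Context: **Signatures and types.** A $\lambda$-signature $\Sigma=\langle S,F,R,\mathrm{Ax}\rangle$ consists of a set $S$ of sorts, a set $F$ of function symbols $f\colon s_1\times\cdots\times s_n\to s_0$ ($n\ge 0$, $s_i\in S$), a set $R$ of relation symbols $p\colon s_1\times\cdots\times s_n$, and a set $\mathrm{Ax}$ of axiom symbols $a\colon A\to B$, where $A,B\in\lambda\mathrm{Types}(\Sigma)$ and $\mathrm{FV}(A\to B)=\emptyset$. For each sort $s$ there is a denumerable set $V_s$ of variables. $\mathrm{LTerms}(\Sigma)$ is generated by: $x:s$ for $x\in V_s$; $f(t_1,\dots,t_n):s_0$ for $f\colon s_1\times\cdots\times s_n\to s_0$ in $F$ and $t_i:s_i\in\mathrm{LTerms}(\Sigma)$. $\lambda\mathrm{Types}(\Sigma)$ is generated by: $0$, $1$; $p(t_1,\dots,t_n)$ for $p\colon s_1\times\cdots\times s_n$ in $R$ and $t_i:s_i\in\mathrm{LTerms}(\Sigma)$; $A\times B$, $A+B$, $A\to B$; $\forall x{:}s.\,A$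 and $\exists x{:}s.\,A$ for $x\in V_s$ (binding $x$). $\mathrm{FV}$ denotes the set of free variables; types are taken up to renaming of bound variables and $A[t/x]$ is capture-avoiding substitution. Types are read as first-order formulae by $0\leftrightarrow\bot$, $1\leftrightarrow\top$, $\times\leftrightarrow\wedge$, $+\leftrightarrow\vee$, $\to\,\leftrightarrow\,\supset$, $\forall\leftrightarrow\forall$, $\exists\leftrightarrow\exists$. **Logical proofs.** A proof of $A$ from assumptions $\Gamma$ (a multiset of formulae), written $\Gamma\vdash A$, is inductively generated by: $\Gamma\vdash A$ if $A\in\Gamma$; $\Gamma\vdash A\supset B$ for each $a\colon A\to B$ in $\mathrm{Ax}$; ($\wedge$I) from $\Gamma\vdash B$, $\Gamma\vdash C$ infer $\Gamma\vdash B\wedge C$; ($\wedge$E) from $\Gamma\vdash A\wedge B$ infer $\Gamma\vdash A$, and infer $\Gamma\vdash B$; ($\vee$I) from $\Gamma\vdash B$ infer $\Gamma\vdash B\vee C$ and $\Gamma\vdash C\vee B$; ($\vee$E) from $\Gamma\vdash B\vee C$, $\Gamma\vdash B\supset A$, $\Gamma\vdash C\supset A$ infer $\Gamma\vdash A$; ($\supset$I) from $\Gamma,C\vdash B$ infer $\Gamma\vdash C\supset B$; ($\supset$E) from $\Gamma\vdash B\supset A$, $\Gamma\vdash B$ infer $\Gamma\vdash A$; ($\top$I) $\Gamma\vdash\top$; ($\bot$E) $\Gamma\vdash\bot\supset B$; ($\forall$I) from $\Gamma\vdash B$ infer $\Gamma\vdash\forall x{:}s.\,B$ if $x:s$ is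 not free in $\Gamma$; ($\forall$E) from $\Gamma\vdash\forall x{:}s.\,B$ infer $\Gamma\vdash B[t/x]$ for $t:s\in\mathrm{LTerms}(\Sigma)$; ($\exists$I) from $\Gamma\vdash B[t/x]$ infer $\Gamma\vdash\exists x{:}s.\,B$; ($\exists$E) from $\Gamma\vdash\exists x{:}s.\,B$, $\Gamma\vdash B\supset A$ infer $\Gamma\vdash A$ if $x:s$ is not free in $\Gamma$ and $x:s\notin\mathrm{FV}(A)$. **$\lambda$-terms.** For each type $t$ there is a denumerable set $W_t$ of typed variables. $\lambda$-terms (which encode proofs rule by rule) are generated by: (1) $x:A$ for $x\in W_A$; (2) $a(t):B$ for $a\colon A\to B$ in $\mathrm{Ax}$, $t:A$; (3) $\langle s,t\rangle:A\times B$ for $s:A$, $t:B$; (4) $\mathrm{fst}(t):A$, $\mathrm{snd}(t):B$ for $t:A\times B$; (5) $\mathrm{inl}_B(t):A+B$, $\mathrm{inr}_B(t):B+A$ for $t:A$; (6) $\mathrm{when}(s,t,r):C$ for $s:A+B$, $t:A\to C$, $r:B\to C$; (7) $(\lambda x{:}A.\,t):A\to B$ for $x\in W_A$, $t:B$ (binding $x:A$); (8) $s\cdot t:B$ for $s:A\to B$, $t:A$; (9) $*:1$; (10) $\mathrm{F}_A:0\to A$; (11) $\mathrm{allI}(\lambda x{:}s.\,t):(\forall x{:}s.\,A)$ for $x\in V_s$, $t:A$ with $x:s\notin\mathrm{FV}^*(t:A)$; (12) $\mathrm{allE}(t,r):A[r/x]$ for $t:(\forall x{:}s.\,A)$, $r:s\in\mathrm{LTerms}(\Sigma)$;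 (13) $\mathrm{exI}_x(t):(\exists x{:}s.\,A)$ for $r:s\in\mathrm{LTerms}(\Sigma)$, $t:A[r/x]$; (14) $\mathrm{exE}(t,(\lambda x{:}s.\,r)):B$ for $t:(\exists x{:}s.\,A)$, $r:A\to B$ with $x:s\notin\mathrm{FV}^*(r:A\to B)$ and $x:s\notin\mathrm{FV}(B)$. $\mathrm{FV}(t:A)$ is the set of free typed variables (in $\bigcup_A W_A$), and $x:s\in\mathrm{FV}^*(t:A)$ iff there is $y:r\in\mathrm{FV}(t:A)$ with $x:s\in\mathrm{FV}(r)$. A context $\vec x:\vec A=x_1:A_1,\dots,x_n:A_n$ is a finite set of distinct typed variables. A term-in-context $\vec x:\vec A.\,t:B$ is a $\lambda$-term with $\mathrm{FV}(t:B)\subseteq\{x_1:A_1,\dots,x_n:A_n\}$. An equality-in-context $\vec x:\vec A.\,t=_B r$ is a pair of terms-in-context $\vec x:\vec A.\,t:B$, $\vec x:\vec A.\,r:B$. **Logically distributive categories.** A category $\mathbb C$ with a map $M\colon\lambda\mathrm{Types}(\Sigma)\to\mathrm{Obj}\,\mathbb C$ is logically distributive if: (1)–(3) $\mathbb C$ has finite products, finite co-products and exponentiation; (4) for all objects $A,B,C$ the arrow $\Delta=[1_A\times\iota_1,1_A\times\iota_2]\colon(A\times B)+(A\times C)\to A\times(B+C)$ has an inverse. For a sort $s$, type $A$, $x\in V_s$, let $\Sigma_A(x{:}s)$ be the functor from the discrete category $\{t:s\mid t:s\in\mathrm{LTerms}(\Sigma)\}$ to $\mathbb C$ with $t:s\mapsto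 M(A[t/x])$. Let $\mathbb C_{\forall x:s.A}$ be the subcategory of $\mathbb C$ whose objects are the vertexes of cones on $\Sigma_A(x{:}s)$ of the form $MB$ with $B\in\lambda\mathrm{Types}(\Sigma)$, $x:s\notin\mathrm{FV}(B)$, and whose arrows, apart from identities, are the arrows of the category of cones over $\Sigma_A(x{:}s)$ having objects of $\mathbb C_{\forall x:s.A}$ as domain and $M(\forall x{:}s.\,A)$ as co-domain (arrows of $\mathbb C$ that are morphisms of cones between cones with these vertexes). Dually, $\mathbb C_{\exists x:s.A}$ has as objects the vertexes of co-cones on $\Sigma_A(x{:}s)$ of the form $MB$ with $x:s\notin\mathrm{FV}(B)$ and as arrows, apart from identities, the arrows of the category of co-cones over $\Sigma_A(x{:}s)$ having $M(\exists x{:}s.\,A)$ as domain and objects of $\mathbb C_{\exists x:s.A}$ as co-domain. (5) All $\mathbb C_{\forall x:s.A}$ have terminal objects and all $\mathbb C_{\exists x:s.A}$ have initial objects; (6) $M0=0$ (initial object), $M1=1$ (terminal object), $M(A\times B)=MA\times MB$, $M(A+B)=MA+MB$, $M(A\to B)=MB^{MA}$, $M(\forall x{:}s.\,A)$ is terminal in $\mathbb C_{\forall x:s.A}$, $M(\exists x{:}s.\,A)$ is initial in $\mathbb C_{\exists x:s.A}$; (7) for $x\in V_s$ and types $A,B$ with $x:s\notin\mathrm{FV}(A)$, the unique arrow $M(\exists x{:}s.\,A\times B)\to MA\times M(\exists x{:}s.\,B)$ in $\mathbb C_{\exists x:s.A\times B}$ has an inverse (the codomain is an object of it, via the co-cone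 obtained from the one of vertex $M(\exists x{:}s.\,B)$ by $1_{MA}\times-$). **Semantics.** A $\Sigma$-structure is $\langle\mathbb C,M,M_{\mathrm{Ax}}\rangle$ with $\mathbb C,M$ logically distributive and $M_{\mathrm{Ax}}(a\colon A\to B)\in\mathrm{Hom}_{\mathbb C}(MA,MB)$ for each $a\in\mathrm{Ax}$. With $A=A_1\times\cdots\times A_n$, $\vec x=x_1:A_1,\dots,x_n:A_n$, the arrow $[\![\vec x.\,t:B]\!]\colon MA\to MB$ is defined by: (1) $[\![\vec x.\,x_i:A_i]\!]=\pi_i$; (2) $[\![\vec x.\,a(t):B]\!]=M_{\mathrm{Ax}}a\circ[\![\vec x.\,t:C]\!]$; (3) $[\![\vec x.\,\langle s,t\rangle]\!]=([\![\vec x.\,s]\!],[\![\vec x.\,t]\!])$; (4) $[\![\vec x.\,\mathrm{fst}(t)]\!]=\pi_1\circ[\![\vec x.\,t]\!]$; (5) $[\![\vec x.\,\mathrm{snd}(t)]\!]=\pi_2\circ[\![\vec x.\,t]\!]$; (6) $[\![\vec x.\,(\lambda z{:}C.\,t):C\to B]\!]$ is the exponential transpose of $[\![\vec x,z:C.\,t:B]\!]$; (7) $[\![\vec x.\,s\cdot t]\!]=\mathrm{ev}\circ([\![\vec x.\,s]\!],[\![\vec x.\,t]\!])$; (8) $[\![\vec x.\,\mathrm{inl}_B(t)]\!]=\iota_1\circ[\![\vec x.\,t]\!]$; (9) $[\![\vec x.\,\mathrm{inr}_C(t)]\!]=\iota_2\circ[\![\vec x.\,t]\!]$; (10) $[\![\vec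 x.\,\mathrm{when}(t,u,v):B]\!]=[\mathrm{ev}\circ([\![\vec x.\,u:C_1\to B]\!]\times 1_{MC_1}),\mathrm{ev}\circ([\![\vec x.\,v:C_2\to B]\!]\times 1_{MC_2})]\circ\Delta^{-1}\circ(1_{MA},[\![\vec x.\,t:C_1+C_2]\!])$; (11) $[\![\vec x.\,*:1]\!]$ is the unique arrow $MA\to 1$; (12) $[\![\vec x.\,\mathrm{F}_B:0\to B]\!]$ is the exponential transpose of $(!\colon 0\to MB)\circ(\pi\colon MA\times 0\to 0)$; (13) $[\![\vec x.\,\mathrm{allI}(\lambda z{:}s.\,t):(\forall z{:}s.\,B)]\!]=\beta\circ\alpha$, where $\alpha\colon MA\to MA'$ is the projection onto the product $MA'$ of the factors corresponding to $\vec x'=\mathrm{FV}(t:B)$, and $\beta\colon MA'\to M(\forall z{:}s.\,B)$ is the universal arrow in $\mathbb C_{\forall z:s.B}$ from the cone $(MA',\{[\![\vec x'.\,t[r/z]:B[r/z]]\!]\}_{r:s})$; (14) $[\![\vec x.\,\mathrm{allE}(t,r):B[r/z]]\!]=p_r\circ[\![\vec x.\,t]\!]$, with $p_r\colon M(\forall z{:}s.\,B)\to M(B[r/z])$ the $r$-th projector of the unique cone on $\Sigma_B(z{:}s)$ with vertex $M(\forall z{:}s.\,B)$; (15) $[\![\vec x.\,\mathrm{exI}_z(t):(\exists z{:}s.\,B)]\!]=j_r\circ[\![\vec x.\,t:B[r/z]]\!]$, with $j_r\colon M(B[r/z])\to M(\exists z{:}s.\,B)$ the $r$-th injection of the unique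 co-cone on $\Sigma_B(z{:}s)$ with vertex $M(\exists z{:}s.\,B)$; (16) $[\![\vec x.\,\mathrm{exE}(t,(\lambda z{:}s.\,r)):B]\!]=\gamma\circ\beta^{-1}\circ(\alpha,[\![\vec x.\,t:(\exists z{:}s.\,C)]\!])$, where $\alpha\colon MA\to MA'$ is the projection corresponding to $\vec x'=\mathrm{FV}(t)\cup\mathrm{FV}(r)$, $\beta\colon M(\exists z{:}s.\,A'\times C)\to MA'\times M(\exists z{:}s.\,C)$ is the co-universal arrow in $\mathbb C_{\exists z:s.A'\times C}$, and $\gamma\colon M(\exists z{:}s.\,A'\times C)\to MB$ is the co-universal arrow in $\mathbb C_{\exists z:s.A'\times C}$ to the co-cone with vertex $MB$ and components $\mathrm{ev}\circ([\![\vec x'.\,r[u/z]:C[u/z]\to B]\!]\times 1_{M(C[u/z])})$, $u:s\in\mathrm{LTerms}(\Sigma)$. A $\Sigma$-structure is a model of an equality-in-context $\vec x.\,s=_B t$ if $[\![\vec x.\,s:B]\!]=[\![\vec x.\,t:B]\!]$; it is a model of $T$ if it is a model of each element of $T$. **Logical consequence.** A type $A$ is a logical consequence of $B_1,\dots,B_n$ in a model $\langle\mathbb N,N,N_{\mathrm{Ax}}\rangle$ when there exists an arrow $N(B_1\times\cdots\times B_n)\to NA$ in $\mathbb N$. $A$ is a logical consequence of $B_1,\dots,B_n$ when it is so in every model (of $T$) in every logically distributive category. *)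

(* Defs.v *)
From Stdlib Require Import List Arith Lia ClassicalEpsilon ProofIrrelevance
  FunctionalExtensionality.
Import ListNotations.

Set Implicit Arguments.
Set Asymmetric Patterns.

Record vocabulary := {
  sort : Type;
  fsym : Type;
  fdom : fsym -> list sort;
  fcod : fsym -> sort;
  rsym : Type;
  rdom : rsym -> list sort }.

(** Syntax is locally nameless, so that renaming of bound variables is equality.
    The free variables of sort [s] are named by [nat]; the list [P] gives the
    sorts of the bound variables in scope, so that LTerms of sort [s] are
    [lterm L [] s], and lambda-types (equivalently, first-order formulae) are
    [ltype L []]. *)

Inductive mem {S : Type} (s : S) : list S -> Type :=
| mO : forall P, mem s (s :: P)
| mS : forall s' P, mem s P -> mem s (s' :: P).
Arguments mO {S s P}.
Arguments mS {S s s' P} _.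

Lemma mem_nil {S : Type} {s : S} (m : mem s []) : False.
Proof. inversion m. Qed.

Definition var {L : vocabulary} (s : sort L) : Type := nat.

Inductive lterm (L : vocabulary) (P : list (sort L)) : sort L -> Type :=
| bvar : forall s, mem s P -> lterm L P s
| fvar : forall s, var s -> lterm L P s
| fapp : forall f : fsym L, lterms L P (fdom L f) -> lterm L P (fcod L f)
with lterms (L : vocabulary) (P : list (sort L)) : list (sort L) -> Type :=
| tnil : lterms L P []
| tcons : forall s l, lterm L P s -> lterms L P l -> lterms L P (s :: l).

Arguments bvar {L P} s _.
Arguments fvar {L P} s _.
Arguments fapp {L P} f _.
Arguments tnil {L P}.
Arguments tcons {L P s l} _ _.

Inductive ltype (L : vocabulary) (P : list (sort L)) : Type :=
| Zero : ltype L P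
| One : ltype L P
| Rel : forall p : rsym L, lterms L P (rdom L p) -> ltype L P
| Prod : ltype L P -> ltype L P -> ltype L P
| Sum : ltype L P -> ltype L P -> ltype L P
| Arr : ltype L P -> ltype L P -> ltype L P
| All : forall s, ltype L (s :: P) -> ltype L P
| Ex : forall s, ltype L (s :: P) -> ltype L P.

Arguments Zero {L P}.
Arguments One {L P}.
Arguments Rel {L P} p _.
Arguments Prod {L P} _ _.
Arguments Sum {L P} _ _.
Arguments Arr {L P} _ _.
Arguments All {L P s} _.
Arguments Ex {L P s} _.

Notation LTerm L s := (lterm L [] s).
Notation LType L := (ltype L []).

Definition fenv (L : vocabulary) (Q : list (sort L)) : Type :=
  forall s, @var L s -> lterm L Q s.
Definition benv (L : vocabulary) (P Q : list (sort L)) : Type :=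
  forall s, mem s P -> lterm L Q s.

Fixpoint tsub {L P Q} (th : fenv L Q) (be : benv L P Q) {s} (t : lterm L P s)
    : lterm L Q s :=
  match t in lterm _ _ s return lterm L Q s with
  | bvar s m => be s m
  | fvar s x => th s x
  | fapp f ts => fapp f (tssub th be ts)
  end
with tssub {L P Q} (th : fenv L Q) (be : benv L P Q) {l} (ts : lterms L P l)
    : lterms L Q l :=
  match ts in lterms _ _ l return lterms L Q l with
  | tnil => tnil
  | tcons s l t ts => tcons (tsub th be t) (tssub th be ts)
  end.

Definition fid {L Q} : fenv L Q := fun s x => fvar s x.
Definition bid {L P} : benv L P P := fun s m => bvar s m.
Definition bshift {L s0 P} : benv L P (s0 :: P) := fun s m => bvar s (mS m).

Definition bcons {L s0 P Q} (t : lterm L Q s0) (be : benv L P Q)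
    : benv L (s0 :: P) Q :=
  fun s m =>
    match m in mem _ l return
      match l with
      | [] => unit
      | s1 :: P1 => lterm L Q s1 -> benv L P1 Q -> lterm L Q s
      end
    with
    | mO _ => fun t _ => t
    | mS _ _ m => fun _ be => be s m
    end t be.

Arguments fid {L Q} s x.
Arguments bid {L P} s m.
Arguments bshift {L s0 P} s m.
Arguments bcons {L s0 P Q} t be s m.

Definition flift {L Q} s0 (th : fenv L Q) : fenv L (s0 :: Q) :=
  fun s x => tsub fid bshift (th s x).
Definition blift {L P Q} s0 (be : benv L P Q) : benv L (s0 :: P) (s0 :: Q) :=
  bcons (bvar s0 mO) (fun s m => tsub fid bshift (be s m)).

Arguments flift {L Q} s0 th s x.
Arguments blift {L P Q} s0 be s m.

Fixpoint asub {L P} (A : ltype L P) {Q} (th : fenv L Q) (be : benv L P Q)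
    : ltype L Q :=
  match A with
  | Zero => Zero
  | One => One
  | Rel p ts => Rel p (tssub th be ts)
  | Prod A B => Prod (asub A th be) (asub B th be)
  | Sum A B => Sum (asub A th be) (asub B th be)
  | Arr A B => Arr (asub A th be) (asub B th be)
  | All s A => All (asub A (flift s th) (blift s be))
  | Ex s A => Ex (asub A (flift s th) (blift s be))
  end.

Definition inst {L P Q} (be : benv L P Q) (A : ltype L P) : ltype L Q :=
  asub A fid be.
Definition wk {L P} (s : sort L) (A : ltype L P) : ltype L (s :: P) :=
  inst bshift A.
Definition embed {L} P (A : LType L) : ltype L P :=
  asub A fid (fun s m => False_rect _ (mem_nil m)).
Arguments wk {L P} s A.
Arguments embed {L} P A.
Definition open {L P s} (B : ltype L (s :: P)) (t : lterm L P s) : ltype L P :=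
  inst (bcons t bid) B.

Definition fupd {L Q} {s : sort L} (x : var s) (t : lterm L Q s) : fenv L Q :=
  fun s' y =>
    match excluded_middle_informative (s = s') with
    | left e =>
        if Nat.eq_dec x y then eq_rect s (lterm L Q) t s' e else fvar s' y
    | right _ => fvar s' y
    end.

Arguments fupd {L Q s} x t s' y : rename.

Definition subst {L} {s : sort L} (x : var s) (t : LTerm L s) (A : LType L)
    : LType L :=
  asub A (fupd x t) bid.

Definition close {L} {s : sort L} (x : var s) (A : LType L) : ltype L [s] :=
  asub A (fupd x (bvar s mO)) bshift.

Definition forallT {L} {s : sort L} (x : var s) (A : LType L) : LType L :=
  All (close x A).
Definition existsT {L} {s : sort L} (x : var s) (A : LType L) : LType L :=
  Ex (close x A).

Fixpoint tfree {L P} {s : sort L} (x : var s) {s'} (t : lterm L P s') : Prop :=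
  match t with
  | bvar _ _ => False
  | fvar s' y => (s', y) = (s, x) :> sort L * nat
  | fapp _ ts => tsfree x ts
  end
with tsfree {L P} {s : sort L} (x : var s) {l} (ts : lterms L P l) : Prop :=
  match ts with
  | tnil => False
  | tcons _ _ t ts => tfree x t \/ tsfree x ts
  end.

Fixpoint free {L P} {s : sort L} (x : var s) (A : ltype L P) : Prop :=
  match A with
  | Zero => False
  | One => False
  | Rel _ ts => tsfree x ts
  | Prod A B => free x A \/ free x B
  | Sum A B => free x A \/ free x B
  | Arr A B => free x A \/ free x B
  | All _ A => free x A
  | Ex _ A => free x A
  end.

Scheme lterm_ind2 := Induction for lterm Sort Prop
with lterms_ind2 := Induction for lterms Sort Prop.
Combined Scheme lterm_lterms_ind from lterm_ind2, lterms_ind2.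

Lemma tsub_ext {L P Q} (th th' : fenv L Q) (be be' : benv L P Q) :
  (forall s m, be s m = be' s m) ->
  (forall s (t : lterm L P s),
     (forall s' (x : var s'), tfree x t -> th s' x = th' s' x) ->
     tsub th be t = tsub th' be' t) /\
  (forall l (ts : lterms L P l),
     (forall s' (x : var s'), tsfree x ts -> th s' x = th' s' x) ->
     tssub th be ts = tssub th' be' ts).
Proof.
intros Hb; apply lterm_lterms_ind; simpl; intros; auto.
- f_equal; auto.
- f_equal; auto.
Qed.

Lemma bcons_eta {L} {s0 : sort L} {P Q} (be : benv L (s0 :: P) Q) s (m : mem s (s0 :: P)) :
  be s m = bcons (be s0 mO) (fun s' m' => be s' (mS m')) s m.
Proof.
revert be.
refine (match m in mem _ l return
  match l return mem s l -> Prop with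
  | [] => fun _ => True
  | s1 :: P1 => fun m => forall be : benv L (s1 :: P1) Q,
      be s m = bcons (be s1 mO) (fun s' m' => be s' (mS m')) s m
  end m with mO _ => _ | mS _ _ _ => _ end); reflexivity.
Qed.

Lemma bext {L} {s0 : sort L} {P Q} (be be' : benv L (s0 :: P) Q) :
  be s0 mO = be' s0 mO ->
  (forall s (m : mem s P), be s (mS m) = be' s (mS m)) ->
  forall s (m : mem s (s0 :: P)), be s m = be' s m.
Proof.
intros H0 H1 s m.
rewrite (bcons_eta be), (bcons_eta be'), H0.
replace (fun s' m' => be s' (mS m')) with (fun s' (m' : mem s' P) => be' s' (mS m'));
  [ reflexivity | ].
apply functional_extensionality_dep; intro s1.
apply functional_extensionality_dep; intro m1. now rewrite H1.
Qed.

Lemma asub_ext {L P} (A : ltype L P) : forall Q (th th' : fenv L Q) (be be' : benv L P Q),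
  (forall s m, be s m = be' s m) ->
  (forall s' (x : var s'), free x A -> th s' x = th' s' x) ->
  asub A th be = asub A th' be'.
Proof.
induction A; simpl; intros Q th th' be be' Hb Hf; auto.
- f_equal. now apply tsub_ext.
- f_equal; auto.
- f_equal; auto.
- f_equal; auto.
- f_equal. apply IHA.
  + apply bext; [ reflexivity | ]. intros s' m. unfold blift; simpl. now rewrite Hb.
  + intros s' x Hx. unfold flift. now rewrite Hf.
- f_equal. apply IHA.
  + apply bext; [ reflexivity | ]. intros s' m. unfold blift; simpl. now rewrite Hb.
  + intros s' x Hx. unfold flift. now rewrite Hf.
Qed.

Lemma tsub_tsub {L P Q R} (th : fenv L Q) (be : benv L P Q) (th' : fenv L R) (be' : benv L Q R) :
  (forall s (t : lterm L P s),
     tsub th' be' (tsub th be t) =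
     tsub (fun s x => tsub th' be' (th s x)) (fun s m => tsub th' be' (be s m)) t) /\
  (forall l (ts : lterms L P l),
     tssub th' be' (tssub th be ts) =
     tssub (fun s x => tsub th' be' (th s x)) (fun s m => tsub th' be' (be s m)) ts).
Proof. apply lterm_lterms_ind; simpl; intros; auto; f_equal; auto. Qed.

Lemma tsub_lift {L Q R} s0 (th' : fenv L R) (be' : benv L Q R) s (t : lterm L Q s) :
  tsub (flift s0 th') (blift s0 be') (tsub fid bshift t) =
  tsub fid bshift (tsub th' be' t).
Proof. rewrite !(proj1 (tsub_tsub _ _ _ _)). now apply tsub_ext. Qed.

Lemma asub_asub {L P} (A : ltype L P) :
  forall Q R (th : fenv L Q) (be : benv L P Q) (th' : fenv L R) (be' : benv L Q R),
  asub (asub A th be) th' be' =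
  asub A (fun s x => tsub th' be' (th s x)) (fun s m => tsub th' be' (be s m)).
Proof.
induction A; simpl; intros Q R th be th' be'; auto.
- f_equal. now apply tsub_tsub.
- f_equal; auto.
- f_equal; auto.
- f_equal; auto.
- f_equal. rewrite IHA. apply asub_ext.
  + apply bext; [ reflexivity | ]. intros s' m. unfold blift at 2 3; simpl. apply tsub_lift.
  + intros s' x _. unfold flift at 2 3. apply tsub_lift.
- f_equal. rewrite IHA. apply asub_ext.
  + apply bext; [ reflexivity | ]. intros s' m. unfold blift at 2 3; simpl. apply tsub_lift.
  + intros s' x _. unfold flift at 2 3. apply tsub_lift.
Qed.

Lemma tsub_id {L P} :
  (forall s (t : lterm L P s), tsub fid bid t = t) /\
  (forall l (ts : lterms L P l), tssub fid bid ts = ts).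
Proof. apply lterm_lterms_ind; simpl; intros; auto; f_equal; auto. Qed.

Lemma asub_id {L P} (A : ltype L P) : asub A fid bid = A.
Proof.
induction A; simpl; auto.
- f_equal. apply tsub_id.
- f_equal; auto.
- f_equal; auto.
- f_equal; auto.
- f_equal. rewrite <- IHA at 2. apply asub_ext; [ | reflexivity ].
  apply bext; reflexivity.
- f_equal. rewrite <- IHA at 2. apply asub_ext; [ | reflexivity ].
  apply bext; reflexivity.
Qed.

Lemma fupd_same {L Q} {s : sort L} (x : var s) (t : lterm L Q s) : fupd x t s x = t.
Proof.
unfold fupd. destruct (excluded_middle_informative (s = s)) as [e|]; [ | congruence ].
destruct (Nat.eq_dec x x); [ | congruence ].
now rewrite (proof_irrelevance _ e eq_refl).
Qed.

Lemma fupd_other {L Q} {s : sort L} (x : var s) (t : lterm L Q s) s' (y : var s') :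
  (s', y) <> (s, x) :> sort L * nat -> fupd x t s' y = fvar s' y.
Proof.
intros H. unfold fupd. destruct (excluded_middle_informative (s = s')) as [e|]; auto.
destruct (Nat.eq_dec x y) as [e'|]; auto.
subst. now destruct H.
Qed.

Lemma tsub_fupd {L P Q} {s : sort L} (x : var s) (t : lterm L P s) (th : fenv L Q)
    (be : benv L P Q) s' (y : var s') :
  (forall s1 (y1 : var s1), (s1, y1) <> (s, x) :> sort L * nat -> th s1 y1 = fvar s1 y1) ->
  tsub th be (fupd x t s' y) = fupd x (tsub th be t) s' y.
Proof.
intros H. destruct (classic ((s', y) = (s, x) :> sort L * nat)) as [e|n].
- injection e; intros -> ->. now rewrite !fupd_same.
- rewrite !fupd_other by auto. simpl. auto.
Qed.

Lemma fupd_id {L Q} {s : sort L} (x : var s) s' (y : var s') :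
  fupd x (fvar s x) s' y = fvar s' y :> lterm L Q s'.
Proof.
destruct (classic ((s', y) = (s, x) :> sort L * nat)) as [e|n].
- injection e; intros -> ->. now rewrite !fupd_same.
- now rewrite !fupd_other by auto.
Qed.

Lemma open_close {L} {s : sort L} (x : var s) (A : LType L) (t : LTerm L s) :
  open (close x A) t = subst x t A.
Proof.
unfold open, close, subst, inst. rewrite asub_asub. apply asub_ext; [ reflexivity | ].
intros s' y _. now rewrite tsub_fupd.
Qed.

Lemma subst_fresh {L} {s : sort L} (x : var s) (t : LTerm L s) (A : LType L) :
  ~ free x A -> subst x t A = A.
Proof.
intros H. unfold subst. rewrite <- asub_id. apply asub_ext; [ reflexivity | ].
intros s' y Hy. apply fupd_other. intros e. injection e; intros -> ->. auto.
Qed.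

Lemma subst_id {L} {s : sort L} (x : var s) (A : LType L) : subst x (fvar s x) A = A.
Proof.
unfold subst. rewrite <- asub_id. apply asub_ext; [ reflexivity | ].
intros s' y _. apply fupd_id.
Qed.

Lemma close_open {L} {s : sort L} (x : var s) (B : ltype L [s]) :
  ~ free x B -> close x (open B (fvar s x)) = B.
Proof.
intros H. unfold open, close, inst. rewrite asub_asub. rewrite <- asub_id.
apply asub_ext.
- apply bext; [ apply fupd_same | ].
  intros s' m. destruct (mem_nil m).
- intros s' y Hy. simpl. apply fupd_other. intros e. injection e; intros -> ->. auto.
Qed.

Lemma subst_open {L} {s : sort L} (x : var s) (B : ltype L [s]) (t : LTerm L s) :
  ~ free x B -> subst x t (open B (fvar s x)) = open B t.
Proof. intros H. now rewrite <- open_close, close_open. Qed.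

Lemma inst_open {L} {s : sort L} {P Q} (be : benv L P Q) (B : ltype L (s :: P)) (t : lterm L P s) :
  inst be (open B t) = open (asub B (flift s fid) (blift s be)) (tsub fid be t).
Proof.
unfold open, inst. rewrite !asub_asub. apply asub_ext; [ | reflexivity ].
apply bext; [ reflexivity | ].
intros s' m. unfold blift; simpl. rewrite (proj1 (tsub_tsub _ _ _ _)).
rewrite <- (proj1 tsub_id (s') (be s' m)) at 1. now apply tsub_ext.
Qed.

Lemma inst_bcons {L} {s : sort L} {P Q} (be : benv L P Q) (B : ltype L (s :: P)) (t : lterm L Q s) :
  inst (bcons t be) B = open (asub B (flift s fid) (blift s be)) t.
Proof.
unfold open, inst. rewrite !asub_asub. apply asub_ext; [ | reflexivity ].
apply bext; [ reflexivity | ].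
intros s' m. unfold blift; simpl. rewrite (proj1 (tsub_tsub _ _ _ _)).
rewrite <- (proj1 tsub_id (s') (be s' m)) at 1. now apply tsub_ext.
Qed.

Lemma inst_wk {L} {s : sort L} {P Q} (be : benv L P Q) (A : ltype L P) (t : lterm L Q s) :
  inst (bcons t be) (wk s A) = inst be A.
Proof. unfold wk, inst. rewrite asub_asub. now apply asub_ext. Qed.

Lemma inst_embed {L} P (be : benv L P []) (A : LType L) : inst be (embed P A) = A.
Proof.
unfold embed, inst. rewrite asub_asub. rewrite <- asub_id. apply asub_ext; [ | reflexivity ].
intros s m. destruct (mem_nil m).
Qed.

Lemma tfree_close {L} {s : sort L} (x : var s) {P} (Q : list (sort L)) (th : fenv L Q) (be : benv L P Q) :
  (forall s' (y : var s'), ~ tfree x (th s' y)) ->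
  (forall s' (m : mem s' P), ~ tfree x (be s' m)) ->
  (forall s' (t : lterm L P s'), ~ tfree x (tsub th be t)) /\
  (forall l (ts : lterms L P l), ~ tsfree x (tssub th be ts)).
Proof. intros H1 H2; apply lterm_lterms_ind; simpl; intros; auto; tauto. Qed.

Lemma free_close {L} {s : sort L} (x : var s) {P} (A : ltype L P) :
  forall (Q : list (sort L)) (th : fenv L Q) (be : benv L P Q),
  (forall s' (y : var s'), ~ tfree x (th s' y)) ->
  (forall s' (m : mem s' P), ~ tfree x (be s' m)) ->
  ~ free x (asub A th be).
Proof.
assert (W : forall Q s0 s' (t : lterm L Q s'), ~ tfree x t -> ~ tfree x (tsub fid (@bshift L s0 Q) t)).
{ intros Q s0.
  refine (fun s' t => proj1 (_ : (forall s' (t : lterm L Q s'), ~ tfree x t -> ~ tfree x (tsub fid (@bshift L s0 Q) t)) /\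
   (forall l (t : lterms L Q l), ~ tsfree x t -> ~ tsfree x (tssub fid (@bshift L s0 Q) t))) s' t).
  apply lterm_lterms_ind; simpl; intros; auto; tauto. }
induction A; simpl; intros Q th be H1 H2; auto.
- now apply tfree_close.
- intros [H|H]; [ eapply IHA1 | eapply IHA2 ]; eauto.
- intros [H|H]; [ eapply IHA1 | eapply IHA2 ]; eauto.
- intros [H|H]; [ eapply IHA1 | eapply IHA2 ]; eauto.
- apply IHA; [ intros; now apply W | ].
  intros s' m. rewrite (bcons_eta (blift s0 be)).
  refine (match m in mem _ l return match l return mem s' l -> Prop with
    [] => fun _ => True | s1 :: P1 => fun m => forall (be : benv L P1 Q),
     (forall s' m, ~ tfree x (be s' m)) -> ~ tfree x
  (bcons (blift s1 be s1 mO) (fun s'0 m' => blift s1 be s'0 (mS m')) s' m) end m with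
   mO _ => _ | mS _ _ _ => _ end be H2); simpl; auto.
- apply IHA; [ intros; now apply W | ].
  intros s' m. rewrite (bcons_eta (blift s0 be)).
  refine (match m in mem _ l return match l return mem s' l -> Prop with
    [] => fun _ => True | s1 :: P1 => fun m => forall (be : benv L P1 Q),
     (forall s' m, ~ tfree x (be s' m)) -> ~ tfree x
  (bcons (blift s1 be s1 mO) (fun s'0 m' => blift s1 be s'0 (mS m')) s' m) end m with
   mO _ => _ | mS _ _ _ => _ end be H2); simpl; auto.
Qed.

Lemma not_free_close {L} {s : sort L} (x : var s) (A : LType L) : ~ free x (close x A).
Proof.
apply free_close.
- intros s' y. destruct (classic ((s', y) = (s, x) :> sort L * nat)) as [e|n].
  + injection e; intros -> ->. rewrite fupd_same. auto.
  + rewrite fupd_other by auto. exact n.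
- intros s' m. destruct (mem_nil m).
Qed.

Lemma fresh_bound {L} (s : sort L) {P} (A : ltype L P) :
  exists n, forall x : var s, free x A -> x < n.
Proof.
assert (T : forall P,
  (forall s' (t : lterm L P s'), exists n, forall x : var s, tfree x t -> x < n) /\
  (forall l (ts : lterms L P l), exists n, forall x : var s, tsfree x ts -> x < n)).
{ intros P'. apply lterm_lterms_ind; simpl; intros.
  - exists 0. tauto.
  - exists (S v). intros x e. injection e; intros -> _. unfold var. lia.
  - auto.
  - exists 0; tauto.
  - destruct H as [n Hn], H0 as [n' Hn']. exists (n + n').
    intros x [Hx|Hx]; [ apply Hn in Hx | apply Hn' in Hx ]; unfold var in *; lia. }
induction A; simpl; auto; try (exists 0; tauto);
  try (destruct IHA1 as [n Hn], IHA2 as [n' Hn']; exists (n + n');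
    intros x [Hx|Hx]; [ apply Hn in Hx | apply Hn' in Hx ]; unfold var in *; lia).
apply T.
Qed.

Lemma fresh_ex {L} (s : sort L) {P Q} (A : ltype L P) (B : ltype L Q) :
  exists x : var s, ~ free x A /\ ~ free x B.
Proof.
destruct (fresh_bound s A) as [n Hn], (fresh_bound s B) as [n' Hn'].
exists (n + n'). split; intros H; [ apply Hn in H | apply Hn' in H ]; unfold var in *; lia.
Qed.

Record signature := {
  voc :> vocabulary;
  ax : Type;
  ax_src : ax -> LType voc;
  ax_tgt : ax -> LType voc;
  ax_closed : forall (a : ax) (s : sort voc) (x : var s),
    ~ free x (Arr (ax_src a) (ax_tgt a)) }.

(** [proves G A] is the inhabitation of the proofs of [A] from the multiset [G],
    with formulae identified with types. *)

Inductive proves (Sg : signature) : list (LType Sg) -> LType Sg -> Prop :=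
| pr_assum : forall G A, In A G -> proves Sg G A
| pr_ax : forall G a, proves Sg G (Arr (ax_src Sg a) (ax_tgt Sg a))
| pr_andI : forall G B C, proves Sg G B -> proves Sg G C -> proves Sg G (Prod B C)
| pr_andE1 : forall G A B, proves Sg G (Prod A B) -> proves Sg G A
| pr_andE2 : forall G A B, proves Sg G (Prod A B) -> proves Sg G B
| pr_orI1 : forall G B C, proves Sg G B -> proves Sg G (Sum B C)
| pr_orI2 : forall G B C, proves Sg G B -> proves Sg G (Sum C B)
| pr_orE : forall G A B C, proves Sg G (Sum B C) ->
    proves Sg G (Arr B A) -> proves Sg G (Arr C A) -> proves Sg G A
| pr_impI : forall G B C, proves Sg (C :: G) B -> proves Sg G (Arr C B)
| pr_impE : forall G A B, proves Sg G (Arr B A) -> proves Sg G B -> proves Sg G A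
| pr_topI : forall G, proves Sg G One
| pr_botE : forall G B, proves Sg G (Arr Zero B)
| pr_allI : forall G s (x : var s) B, (forall C, In C G -> ~ free x C) ->
    proves Sg G B -> proves Sg G (forallT x B)
| pr_allE : forall G s (x : var s) B (t : LTerm Sg s),
    proves Sg G (forallT x B) -> proves Sg G (subst x t B)
| pr_exI : forall G s (x : var s) B (t : LTerm Sg s),
    proves Sg G (subst x t B) -> proves Sg G (existsT x B)
| pr_exE : forall G s (x : var s) A B,
    (forall C, In C G -> ~ free x C) -> ~ free x A ->
    proves Sg G (existsT x B) -> proves Sg G (Arr B A) -> proves Sg G A.

(** [tm D A] is the type of lambda-terms of type [A] in the context [D], up to
    renaming of bound variables: the variable of index [i] is the [i]-th entry of
    [D], and [P] lists the sorts of the logical variables bound by the enclosing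
    [t_allI] and [t_exE].  Lifting [D] (and, for [t_exE], the type [B]) over the
    variable [x:s] being bound expresses that [x:s] is neither in FV* of the body
    nor in FV(B). *)

Inductive tm (Sg : signature) :
    forall P : list (sort Sg), list (ltype Sg P) -> ltype Sg P -> Type :=
| t_var : forall P (D : list (ltype Sg P)) i, i < length D -> tm Sg D (nth i D One)
| t_ax : forall P (D : list (ltype Sg P)) a,
    tm Sg D (embed P (ax_src Sg a)) -> tm Sg D (embed P (ax_tgt Sg a))
| t_pair : forall P (D : list (ltype Sg P)) A B, tm Sg D A -> tm Sg D B -> tm Sg D (Prod A B)
| t_fst : forall P (D : list (ltype Sg P)) A B, tm Sg D (Prod A B) -> tm Sg D A
| t_snd : forall P (D : list (ltype Sg P)) A B, tm Sg D (Prod A B) -> tm Sg D B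
| t_inl : forall P (D : list (ltype Sg P)) A B, tm Sg D A -> tm Sg D (Sum A B)
| t_inr : forall P (D : list (ltype Sg P)) A B, tm Sg D A -> tm Sg D (Sum B A)
| t_when : forall P (D : list (ltype Sg P)) A B C,
    tm Sg D (Sum A B) -> tm Sg D (Arr A C) -> tm Sg D (Arr B C) -> tm Sg D C
| t_lam : forall P (D : list (ltype Sg P)) A B, tm Sg (A :: D) B -> tm Sg D (Arr A B)
| t_app : forall P (D : list (ltype Sg P)) A B, tm Sg D (Arr A B) -> tm Sg D A -> tm Sg D B
| t_star : forall P (D : list (ltype Sg P)), tm Sg D One
| t_F : forall P (D : list (ltype Sg P)) A, tm Sg D (Arr Zero A)
| t_allI : forall P (D : list (ltype Sg P)) s (A : ltype Sg (s :: P)),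
    tm Sg (map (wk s) D) A -> tm Sg D (All A)
| t_allE : forall P (D : list (ltype Sg P)) s (A : ltype Sg (s :: P)) (r : lterm Sg P s),
    tm Sg D (All A) -> tm Sg D (open A r)
| t_exI : forall P (D : list (ltype Sg P)) s (A : ltype Sg (s :: P)) (r : lterm Sg P s),
    tm Sg D (open A r) -> tm Sg D (Ex A)
| t_exE : forall P (D : list (ltype Sg P)) s (A : ltype Sg (s :: P)) B,
    tm Sg D (Ex A) -> tm Sg (map (wk s) D) (Arr A (wk s B)) -> tm Sg D B.

Fixpoint FV {Sg : signature} {P : list (sort Sg)} {D : list (ltype Sg P)} {A}
    (t : tm Sg D A) : list nat :=
  match t with
  | t_var _ _ i _ => [i]
  | t_ax _ _ _ t => FV t
  | t_pair _ _ _ _ t u => FV t ++ FV u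
  | t_fst _ _ _ _ t => FV t
  | t_snd _ _ _ _ t => FV t
  | t_inl _ _ _ _ t => FV t
  | t_inr _ _ _ _ t => FV t
  | t_when _ _ _ _ _ t u v => FV t ++ FV u ++ FV v
  | t_lam _ _ _ _ t => flat_map (fun i => match i with 0 => [] | S j => [j] end) (FV t)
  | t_app _ _ _ _ t u => FV t ++ FV u
  | t_star _ _ => []
  | t_F _ _ _ => []
  | t_allI _ _ _ _ t => FV t
  | t_allE _ _ _ _ _ t => FV t
  | t_exI _ _ _ _ _ t => FV t
  | t_exE _ _ _ _ _ t u => FV t ++ FV u
  end.

Record equation (Sg : signature) := {
  eq_ctx : list (LType Sg);
  eq_type : LType Sg;
  eq_lhs : tm Sg eq_ctx eq_type;
  eq_rhs : tm Sg eq_ctx eq_type }.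

Definition theory (Sg : signature) : Type := equation Sg -> Prop.

Record category := {
  ob :> Type;
  hom : ob -> ob -> Type;
  idm : forall X, hom X X;
  comp : forall X Y Z, hom Y Z -> hom X Y -> hom X Z;
  comp_idl : forall X Y (f : hom X Y), comp (idm Y) f = f;
  comp_idr : forall X Y (f : hom X Y), comp f (idm X) = f;
  comp_assoc : forall X Y Z W (h : hom Z W) (g : hom Y Z) (f : hom X Y),
    comp h (comp g f) = comp (comp h g) f }.
Arguments hom {c} _ _.
Arguments idm {c} X.
Arguments comp {c X Y Z} _ _.
Infix "∘" := comp (at level 40, left associativity).

Definition eq_hom {C : category} {X Y : C} (e : X = Y) : hom X Y :=
  match e with eq_refl => idm X end.

Definition is_id {C : category} {X Y : C} (f : hom X Y) : Prop :=
  exists e : X = Y, f = eq_hom e.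

Record inverse {C : category} {X Y : C} (f : hom X Y) := {
  inv : hom Y X;
  inv_l : inv ∘ f = idm X;
  inv_r : f ∘ inv = idm Y }.

Record terminal {C : category} (T : C) := {
  to_T : forall X, hom X T;
  to_T_uniq : forall X (f : hom X T), f = to_T X }.

Record initial {C : category} (I : C) := {
  from_I : forall X, hom I X;
  from_I_uniq : forall X (f : hom I X), f = from_I X }.

Record product {C : category} (A B : C) := {
  prod_ob : C;
  pr1 : hom prod_ob A;
  pr2 : hom prod_ob B;
  pair : forall {X}, hom X A -> hom X B -> hom X prod_ob;
  pair_1 : forall X (f : hom X A) (g : hom X B), pr1 ∘ pair f g = f;
  pair_2 : forall X (f : hom X A) (g : hom X B), pr2 ∘ pair f g = g;
  pair_uniq : forall X (h : hom X prod_ob), h = pair (pr1 ∘ h) (pr2 ∘ h) }.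

Record coproduct {C : category} (A B : C) := {
  sum_ob : C;
  in1 : hom A sum_ob;
  in2 : hom B sum_ob;
  copair : forall {X}, hom A X -> hom B X -> hom sum_ob X;
  copair_1 : forall X (f : hom A X) (g : hom B X), copair f g ∘ in1 = f;
  copair_2 : forall X (f : hom A X) (g : hom B X), copair f g ∘ in2 = g;
  copair_uniq : forall X (h : hom sum_ob X), h = copair (h ∘ in1) (h ∘ in2) }.

Record exponential {C : category} (prods : forall X Y : C, product X Y) (B A : C) := {
  exp_ob : C;
  ev : hom (prod_ob (prods exp_ob A)) B;
  curry : forall {X}, hom (prod_ob (prods X A)) B -> hom X exp_ob;
  ev_curry : forall X (f : hom (prod_ob (prods X A)) B),
    ev ∘ pair (prods _ _) (curry f ∘ pr1 (prods X A)) (pr2 (prods X A)) = f;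
  curry_uniq : forall X (h : hom X exp_ob),
    h = curry (ev ∘ pair (prods _ _) (h ∘ pr1 (prods X A)) (pr2 (prods X A))) }.

Record bicartesian := {
  bc_cat :> category;
  bc_1 : bc_cat;
  bc_1_terminal : terminal bc_1;
  bc_0 : bc_cat;
  bc_0_initial : initial bc_0;
  bc_prod : forall A B : bc_cat, product A B;
  bc_sum : forall A B : bc_cat, coproduct A B;
  bc_exp : forall B A : bc_cat, exponential bc_prod B A }.

Section BicartesianOperations.
Context {C : bicartesian}.

Definition times (A B : C) : C := prod_ob (bc_prod C A B).
Definition plus (A B : C) : C := sum_ob (bc_sum C A B).
Definition power (B A : C) : C := exp_ob (bc_exp C B A).
Definition pi1 {A B : C} : hom (times A B) A := pr1 (bc_prod C A B).
Definition pi2 {A B : C} : hom (times A B) B := pr2 (bc_prod C A B).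
Definition pairing {X A B : C} (f : hom X A) (g : hom X B) : hom X (times A B) :=
  pair (bc_prod C A B) f g.
Definition cross {A A' B B' : C} (f : hom A A') (g : hom B B') :
    hom (times A B) (times A' B') := pairing (f ∘ pi1) (g ∘ pi2).
Definition iota1 {A B : C} : hom A (plus A B) := in1 (bc_sum C A B).
Definition iota2 {A B : C} : hom B (plus A B) := in2 (bc_sum C A B).
Definition copairing {X A B : C} (f : hom A X) (g : hom B X) : hom (plus A B) X :=
  copair (bc_sum C A B) f g.
Definition eval {A B : C} : hom (times (power B A) A) B := ev (bc_exp C B A).
Definition transpose {X A B : C} (f : hom (times X A) B) : hom X (power B A) :=
  curry (bc_exp C B A) f.
Definition bang (X : C) : hom X (bc_1 C) := to_T (bc_1_terminal C) X.
Definition cobang (X : C) : hom (bc_0 C) X := from_I (bc_0_initial C) X.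

Definition Delta (A B D : C) : hom (plus (times A B) (times A D)) (times A (plus B D)) :=
  copairing (cross (idm A) iota1) (cross (idm A) iota2).

End BicartesianOperations.

Record cone {C : category} {I : Type} (F : I -> C) := {
  vertex : C;
  leg : forall i, hom vertex (F i) }.

Record cocone {C : category} {I : Type} (F : I -> C) := {
  covertex : C;
  coleg : forall i, hom (F i) covertex }.

Definition cone_hom {C : category} {I} {F : I -> C} (c d : cone F) : Type :=
  {f : hom (vertex c) (vertex d) | forall i, leg d i ∘ f = leg c i}.
Definition cocone_hom {C : category} {I} {F : I -> C} (c d : cocone F) : Type :=
  {f : hom (covertex c) (covertex d) | forall i, f ∘ coleg c i = coleg d i}.

Lemma sig_eq {T : Type} {P : T -> Prop} (u v : {x | P x}) : proj1_sig u = proj1_sig v -> u = v.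
Proof. apply eq_sig_hprop. intros; apply proof_irrelevance. Qed.

Definition cone_id {C : category} {I} {F : I -> C} (c : cone F) : cone_hom c c :=
  exist (fun f : hom (vertex c) (vertex c) => forall i, leg c i ∘ f = leg c i)
    (idm _) (fun i => comp_idr _ _ _ (leg c i)).
Definition cone_comp {C : category} {I} {F : I -> C} (c d e : cone F)
    (g : cone_hom d e) (f : cone_hom c d) : cone_hom c e.
Proof.
exists (proj1_sig g ∘ proj1_sig f).
intros i. now rewrite comp_assoc, (proj2_sig g), (proj2_sig f).
Defined.

Definition cones {C : category} {I} (F : I -> C) : category.
Proof.
refine {| ob := cone F; hom := cone_hom; idm := cone_id; comp := cone_comp |};
  intros; apply sig_eq; simpl.
- apply comp_idl.
- apply comp_idr.
- apply comp_assoc.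
Defined.

Definition cocone_id {C : category} {I} {F : I -> C} (c : cocone F) : cocone_hom c c :=
  exist (fun f : hom (covertex c) (covertex c) => forall i, f ∘ coleg c i = coleg c i)
    (idm _) (fun i => comp_idl _ _ _ (coleg c i)).
Definition cocone_comp {C : category} {I} {F : I -> C} (c d e : cocone F)
    (g : cocone_hom d e) (f : cocone_hom c d) : cocone_hom c e.
Proof.
exists (proj1_sig g ∘ proj1_sig f).
intros i. now rewrite <- comp_assoc, (proj2_sig f), (proj2_sig g).
Defined.

Definition cocones {C : category} {I} (F : I -> C) : category.
Proof.
refine {| ob := cocone F; hom := cocone_hom; idm := cocone_id; comp := cocone_comp |};
  intros; apply sig_eq; simpl.
- apply comp_idl.
- apply comp_idr.
- apply comp_assoc.
Defined.

Definition subcategory (C : category) (obs : C -> Prop)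
    (arrows : forall X Y : C, hom X Y -> Prop)
    (arrows_id : forall X, arrows X X (idm X))
    (arrows_comp : forall X Y Z (g : hom Y Z) (f : hom X Y),
      arrows Y Z g -> arrows X Y f -> arrows X Z (g ∘ f)) : category.
Proof.
refine {| ob := {X : C | obs X};
  hom := fun X Y => {f : hom (proj1_sig X) (proj1_sig Y) | arrows _ _ f};
  idm := fun X => exist _ (idm (proj1_sig X)) (arrows_id _);
  comp := fun X Y Z g f => exist _ (proj1_sig g ∘ proj1_sig f)
    (arrows_comp _ _ _ _ _ (proj2_sig g) (proj2_sig f)) |};
  intros; apply sig_eq; simpl.
- apply comp_idl.
- apply comp_idr.
- apply comp_assoc.
Defined.

Definition Sigma {L : vocabulary} {C : category} (M : LType L -> C)
    {s : sort L} (x : var s) (A : LType L) : LTerm L s -> C :=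
  fun t => M (subst x t A).

(** The objects are cones rather than bare vertexes: universal arrows are taken from
    cones, and a vertex may carry several of them.  Identifying the cones with the
    same vertex would make every arrow from [M (existsT x One)] to [M (Sum One One)]
    equal, and so force any two parallel arrows of the category to be equal. *)
Definition forall_cat {L : vocabulary} {C : category} (M : LType L -> C)
    {s : sort L} (x : var s) (A : LType L) : category.
Proof.
refine (subcategory (cones (Sigma M x A))
  (fun c => exists B, ~ free x B /\ vertex c = M B)
  (fun c d f => is_id f \/ vertex d = M (forallT x A)) _ _).
- intros c. left. now exists eq_refl.
- intros c d e g f [[E ->]|Hg] Hf; [ | now right ].
  subst e. change (eq_hom eq_refl) with (idm d). rewrite comp_idl. exact Hf.
Defined.

Definition exists_cat {L : vocabulary} {C : category} (M : LType L -> C)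
    {s : sort L} (x : var s) (A : LType L) : category.
Proof.
refine (subcategory (cocones (Sigma M x A))
  (fun c => exists B, ~ free x B /\ covertex c = M B)
  (fun c d f => is_id f \/ covertex c = M (existsT x A)) _ _).
- intros c. left. now exists eq_refl.
- intros c d e g f Hg [[E ->]|Hf]; [ | now right ].
  subst d. change (eq_hom eq_refl) with (idm c). rewrite comp_idr. exact Hg.
Defined.

Definition forall_ob {L : vocabulary} {C : category} (M : LType L -> C)
    {s : sort L} (x : var s) (A : LType L) (X : C) (B : LType L)
    (HB : ~ free x B) (HX : X = M B) (p : forall t, hom X (M (subst x t A))) :
    forall_cat M x A :=
  exist (fun c : cone (Sigma M x A) => exists B, ~ free x B /\ vertex c = M B)
    {| vertex := X; leg := p |} (ex_intro _ B (conj HB HX)).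

Definition exists_ob {L : vocabulary} {C : category} (M : LType L -> C)
    {s : sort L} (x : var s) (A : LType L) (X : C) (B : LType L)
    (HB : ~ free x B) (HX : X = M B) (j : forall t, hom (M (subst x t A)) X) :
    exists_cat M x A :=
  exist (fun c : cocone (Sigma M x A) => exists B, ~ free x B /\ covertex c = M B)
    {| covertex := X; coleg := j |} (ex_intro _ B (conj HB HX)).

Definition Mcast {L : vocabulary} {C : category} (M : LType L -> C) {A B : LType L}
    (e : A = B) : hom (M A) (M B) := eq_hom (f_equal M e).

(** The equations on [ld_M] are equalities of objects, transported to arrows by
    [eq_hom].  [ld_proj] and [ld_inj] are the distinguished cone and co-cone on the images of
    the quantified types; they are indexed by the binder body, so that they do not
    depend on the name of the bound variable.  Existence of terminal objects in
    [forall_cat] and of initial objects in [exists_cat] is part of [ld_forall] and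
    [ld_exists]. *)
Record ld_data (L : vocabulary) := {
  ld_cat :> bicartesian;
  ld_distr : forall A B D : ld_cat, inverse (Delta A B D);
  ld_M : LType L -> ld_cat;
  ld_0 : ld_M Zero = bc_0 ld_cat;
  ld_1 : ld_M One = bc_1 ld_cat;
  ld_prod : forall A B, ld_M (Prod A B) = times (ld_M A) (ld_M B);
  ld_sum : forall A B, ld_M (Sum A B) = plus (ld_M A) (ld_M B);
  ld_arr : forall A B, ld_M (Arr A B) = power (ld_M B) (ld_M A);
  ld_proj : forall s (B : ltype L [s]) (t : LTerm L s), hom (ld_M (All B)) (ld_M (open B t));
  ld_inj : forall s (B : ltype L [s]) (t : LTerm L s), hom (ld_M (open B t)) (ld_M (Ex B));
  ld_forall : forall s (x : var s) (A : LType L),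
    terminal (forall_ob ld_M x A (forallT x A) (not_free_close x A) eq_refl
      (fun t => Mcast ld_M (open_close x A t) ∘ ld_proj (close x A) t));
  ld_exists : forall s (x : var s) (A : LType L),
    initial (exists_ob ld_M x A (existsT x A) (not_free_close x A) eq_refl
      (fun t => ld_inj (close x A) t ∘ Mcast ld_M (eq_sym (open_close x A t)))) }.

Section UniversalArrows.
Context {L : vocabulary} {N : ld_data L}.
Let M := ld_M N.
Context {s : sort L} (x : var s) (A : LType L).

Definition forall_arrow (X : N) (B : LType L) (HB : ~ free x B) (HX : X = M B)
    (p : forall t, hom X (M (subst x t A))) : hom X (M (forallT x A)) :=
  proj1_sig (proj1_sig (to_T (ld_forall N x A) (forall_ob M x A B HB HX p))).

Definition exists_arrow (X : N) (B : LType L) (HB : ~ free x B) (HX : X = M B)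
    (j : forall t, hom (M (subst x t A)) X) : hom (M (existsT x A)) X :=
  proj1_sig (proj1_sig (from_I (ld_exists N x A) (exists_ob M x A B HB HX j))).

End UniversalArrows.

Definition frobenius {L : vocabulary} (N : ld_data L) {s : sort L} (x : var s)
    (A B : LType L) (HA : ~ free x A) :
    hom (ld_M N (existsT x (Prod A B))) (times (ld_M N A) (ld_M N (existsT x B))) :=
  exists_arrow x (Prod A B) (Prod A (existsT x B))
    (fun H => match H with
              | or_introl H => HA H
              | or_intror H => not_free_close x B H
              end)
    (eq_sym (ld_prod N A (existsT x B)))
    (fun t =>
       cross (Mcast (ld_M N) (subst_fresh x t A HA))
             (ld_inj N (close x B) t ∘ Mcast (ld_M N) (eq_sym (open_close x B t)))
       ∘ eq_hom (ld_prod N (subst x t A) (subst x t B))).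

Record ld_category (L : vocabulary) := {
  ldc :> ld_data L;
  ld_frobenius : forall s (x : var s) (A B : LType L) (HA : ~ free x A),
    inverse (frobenius ldc x A B HA) }.

Record structure (Sg : signature) := {
  st_ld :> ld_category Sg;
  st_ax : forall a : ax Sg, hom (ld_M st_ld (ax_src Sg a)) (ld_M st_ld (ax_tgt Sg a)) }.

Fixpoint prodT {L : vocabulary} (l : list (LType L)) : LType L :=
  match l with
  | [] => One
  | A :: l' => match l' with [] => A | _ => Prod A (prodT l') end
  end.

Lemma In_tail (a i : nat) (U : list nat) : a <> i -> In i (a :: U) -> In i U.
Proof. now intros H [e|e]. Qed.

Section Contexts.
Context {L : vocabulary} (N : ld_data L).
Local Notation M := (ld_M N).

Definition ctx_head (A : LType L) (l : list (LType L)) : hom (M (prodT (A :: l))) (M A) :=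
  match l with
  | [] => idm (M A)
  | B :: l' => pi1 ∘ eq_hom (ld_prod N A (prodT (B :: l')))
  end.

Definition ctx_tail (A : LType L) (l : list (LType L)) :
    hom (M (prodT (A :: l))) (M (prodT l)) :=
  match l with
  | [] => eq_hom (eq_sym (ld_1 N)) ∘ bang (M A)
  | B :: l' => pi2 ∘ eq_hom (ld_prod N A (prodT (B :: l')))
  end.

Definition ctx_cons (A : LType L) (l : list (LType L)) (X : N) (f : hom X (M A)) :
    hom X (M (prodT l)) -> hom X (M (prodT (A :: l))) :=
  match l with
  | [] => fun _ => f
  | B :: l' => fun g => eq_hom (eq_sym (ld_prod N A (prodT (B :: l')))) ∘ pairing f g
  end.

(** A context is given by the list [U] of its variables and their types [ty]. *)

Fixpoint ctx_proj (ty : nat -> LType L) (U : list nat) (i : nat) :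
    In i U -> hom (M (prodT (map ty U))) (M (ty i)) :=
  match U return In i U -> hom (M (prodT (map ty U))) (M (ty i)) with
  | [] => fun H : False => False_rect _ H
  | a :: U' =>
      match Nat.eq_dec a i with
      | left e => fun _ => Mcast M (f_equal ty e) ∘ ctx_head (ty a) (map ty U')
      | right n => fun H =>
          ctx_proj ty U' i (In_tail n H) ∘ ctx_tail (ty a) (map ty U')
      end
  end.

Fixpoint ctx_tuple (ty : nat -> LType L) (U : list nat) (X : N) :
    (forall i, In i U -> hom X (M (ty i))) -> hom X (M (prodT (map ty U))) :=
  match U return
    (forall i, In i U -> hom X (M (ty i))) -> hom X (M (prodT (map ty U)))
  with
  | [] => fun _ => eq_hom (eq_sym (ld_1 N)) ∘ bang X
  | a :: U' => fun f =>
      ctx_cons (ty a) (map ty U') X (f a (or_introl eq_refl))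
        (ctx_tuple ty U' X (fun i H => f i (or_intror H)))
  end.

Definition ctx_restrict (ty : nat -> LType L) (U U' : list nat) (H : incl U' U) :
    hom (M (prodT (map ty U))) (M (prodT (map ty U'))) :=
  ctx_tuple ty U' _ (fun i Hi => ctx_proj ty U i (H i Hi)).

(** The context extended at its end with a variable of type [A], under the
    renumbering of variables done by [t_lam]. *)

Definition ty_ext (A : LType L) (ty : nat -> LType L) (i : nat) : LType L :=
  match i with 0 => A | S j => ty j end.

Definition ctx_snoc (U : list nat) : list nat := map S U ++ [0].

Lemma In_ctx_snoc (U : list nat) (j : nat) : In (S j) (ctx_snoc U) -> In j U.
Proof.
unfold ctx_snoc. rewrite in_app_iff, in_map_iff.
intros [[k [e Hk]]|[e|[]]]; [ | discriminate ].
now injection e; intros ->.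
Qed.

Definition ctx_extend (A : LType L) (ty : nat -> LType L) (U : list nat) :
    hom (times (M (prodT (map ty U))) (M A)) (M (prodT (map (ty_ext A ty) (ctx_snoc U)))) :=
  ctx_tuple (ty_ext A ty) (ctx_snoc U) _ (fun i =>
    match i return
      In i (ctx_snoc U) -> hom (times (M (prodT (map ty U))) (M A)) (M (ty_ext A ty i))
    with
    | 0 => fun _ => pi2
    | S j => fun H => ctx_proj ty U j (In_ctx_snoc U j H) ∘ pi1
    end).

End Contexts.

Lemma incl_FV_lam (l U : list nat) :
  incl (flat_map (fun i => match i with 0 => [] | S j => [j] end) l) U ->
  incl l (ctx_snoc U).
Proof.
intros H i Hi. unfold ctx_snoc. rewrite in_app_iff, in_map_iff. destruct i as [|j].
- right. now left.
- left. exists j. split; [ reflexivity | ]. apply H, in_flat_map. exists (S j).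
  split; [ exact Hi | now left ].
Qed.

Lemma incl_nodup (l : list nat) : incl l (nodup Nat.eq_dec l).
Proof. intros i. apply nodup_In. Qed.

Lemma nodup_incl (l U : list nat) : incl l U -> incl (nodup Nat.eq_dec l) U.
Proof. intros H i Hi. apply H. now apply nodup_In in Hi. Qed.

Lemma ty_wk {L} {P : list (sort L)} (D : list (ltype L P)) (be : benv L P []) (s : sort L)
    (r : LTerm L s) (ty : nat -> LType L) :
  (forall i, ty i = inst be (nth i D One)) ->
  forall i, ty i = inst (bcons r be) (nth i (map (wk s) D) One).
Proof.
intros H i. change One with (wk s (@One L P)). now rewrite map_nth, inst_wk.
Qed.

Lemma ty_lam {L} {P : list (sort L)} (D : list (ltype L P)) (be : benv L P [])
    (A : ltype L P) (ty : nat -> LType L) :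
  (forall i, ty i = inst be (nth i D One)) ->
  forall i, ty_ext (inst be A) ty i = inst be (nth i (A :: D) One).
Proof. intros H [|i]; simpl; auto. Qed.

Definition fresh {L : vocabulary} (s : sort L) {P Q} (A : ltype L P) (B : ltype L Q) :
    {x : var s | ~ free x A /\ ~ free x B} :=
  constructive_indefinite_description _ (fresh_ex s A B).

Section Quantifiers.
Context {L : vocabulary} (N : ld_category L).
Local Notation M := (ld_M N).

(** The universal arrow from the cone with vertex [M G] and legs [p], the bound
    variable being named by a fresh [z]. *)
Definition sem_allI {s : sort L} (G : LType L) (B : ltype L [s])
    (p : forall r : LTerm L s, hom (M G) (M (open B r))) : hom (M G) (M (All B)) :=
  let (z, H) := fresh s G B in
  Mcast M (f_equal All (close_open z B (proj2 H))) ∘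
  forall_arrow z (open B (fvar s z)) G (proj1 H) eq_refl
    (fun r => Mcast M (eq_sym (subst_open z B r (proj2 H))) ∘ p r).

(** The composite of the co-universal arrow to the co-cone with vertex [M B] and the
    inverse of the Frobenius arrow, the bound variable being named by a fresh [z]. *)
Definition sem_exE {s : sort L} (G : LType L) (A : ltype L [s]) (B : LType L)
    (r : forall u : LTerm L s, hom (M G) (M (Arr (open A u) B))) :
    hom (times (M G) (M (Ex A))) (M B) :=
  let (z, H) := fresh s (Prod G B) A in
  let HG := fun h => proj1 H (or_introl h) in
  let HB := fun h => proj1 H (or_intror h) in
  let Az := open A (fvar s z) in
  let gamma := exists_arrow z (Prod G Az) B HB eq_refl (fun u =>
    eval ∘ cross (eq_hom (ld_arr N (open A u) B) ∘ r u) (idm (M (open A u)))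
    ∘ cross (Mcast M (subst_fresh z u G HG)) (Mcast M (subst_open z A u (proj2 H)))
    ∘ eq_hom (ld_prod N (subst z u G) (subst z u Az))) in
  gamma ∘ inv (ld_frobenius N z G Az HG)
  ∘ cross (idm (M G)) (Mcast M (f_equal Ex (eq_sym (close_open z A (proj2 H))))).

End Quantifiers.

(** [sem t be ty U] is the denotation, in the context of variables [U] of types [ty],
    of the instance of [t] obtained by substituting [be] for the bound logical
    variables in scope. *)
Fixpoint sem {Sg : signature} (N : structure Sg) {P : list (sort Sg)}
    {D : list (ltype Sg P)} {A : ltype Sg P} (t : tm Sg D A) {struct t} :
    forall (be : benv Sg P []) (ty : nat -> LType Sg),
    (forall i, ty i = inst be (nth i D One)) ->
    forall U : list nat, incl (FV t) U ->
    hom (ld_M N (prodT (map ty U))) (ld_M N (inst be A)) :=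
  match t in @tm _ P D A return
    forall (be : benv Sg P []) (ty : nat -> LType Sg),
    (forall i, ty i = inst be (nth i D One)) ->
    forall U : list nat, incl (FV t) U ->
    hom (ld_M N (prodT (map ty U))) (ld_M N (inst be A))
  with
  | t_var _ _ i _ => fun be ty Hty U HU =>
      Mcast (ld_M N) (Hty i) ∘ ctx_proj N ty U i (HU i (or_introl eq_refl))
  | t_ax _ _ a t => fun be ty Hty U HU =>
      Mcast (ld_M N) (eq_sym (inst_embed be (ax_tgt Sg a))) ∘ st_ax N a ∘
      Mcast (ld_M N) (inst_embed be (ax_src Sg a)) ∘ sem N t be ty Hty HU
  | t_pair _ _ A B t u => fun be ty Hty U HU =>
      eq_hom (eq_sym (ld_prod N (inst be A) (inst be B))) ∘
      pairing (sem N t be ty Hty (fun i h => HU i (in_or_app _ _ i (or_introl h))))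
              (sem N u be ty Hty (fun i h => HU i (in_or_app _ _ i (or_intror h))))
  | t_fst _ _ A B t => fun be ty Hty U HU =>
      pi1 ∘ eq_hom (ld_prod N (inst be A) (inst be B)) ∘ sem N t be ty Hty HU
  | t_snd _ _ A B t => fun be ty Hty U HU =>
      pi2 ∘ eq_hom (ld_prod N (inst be A) (inst be B)) ∘ sem N t be ty Hty HU
  | t_inl _ _ A B t => fun be ty Hty U HU =>
      eq_hom (eq_sym (ld_sum N (inst be A) (inst be B))) ∘ iota1 ∘ sem N t be ty Hty HU
  | t_inr _ _ A B t => fun be ty Hty U HU =>
      eq_hom (eq_sym (ld_sum N (inst be B) (inst be A))) ∘ iota2 ∘ sem N t be ty Hty HU
  | t_when _ _ A B C t u v => fun be ty Hty U HU =>
      let t' := sem N t be ty Hty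
        (fun i h => HU i (in_or_app _ _ i (or_introl h))) in
      let u' := sem N u be ty Hty
        (fun i h => HU i (in_or_app _ _ i (or_intror (in_or_app _ _ i (or_introl h))))) in
      let v' := sem N v be ty Hty
        (fun i h => HU i (in_or_app _ _ i (or_intror (in_or_app _ _ i (or_intror h))))) in
      copairing
        (eval ∘ cross (eq_hom (ld_arr N (inst be A) (inst be C)) ∘ u') (idm _))
        (eval ∘ cross (eq_hom (ld_arr N (inst be B) (inst be C)) ∘ v') (idm _))
      ∘ inv (ld_distr N _ _ _)
      ∘ pairing (idm _) (eq_hom (ld_sum N (inst be A) (inst be B)) ∘ t')
  | t_lam _ D A B t => fun be ty Hty U HU =>
      eq_hom (eq_sym (ld_arr N (inst be A) (inst be B))) ∘
      transpose
        (sem N t be (ty_ext (inst be A) ty) (ty_lam D be A ty Hty) (incl_FV_lam _ HU)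
         ∘ ctx_extend N (inst be A) ty U)
  | t_app _ _ A B t u => fun be ty Hty U HU =>
      eval ∘ pairing
        (eq_hom (ld_arr N (inst be A) (inst be B)) ∘
         sem N t be ty Hty (fun i h => HU i (in_or_app _ _ i (or_introl h))))
        (sem N u be ty Hty (fun i h => HU i (in_or_app _ _ i (or_intror h))))
  | t_star _ _ => fun be ty Hty U HU =>
      eq_hom (eq_sym (ld_1 N)) ∘ bang _
  | t_F _ _ B => fun be ty Hty U HU =>
      eq_hom (eq_sym (ld_arr N Zero (inst be B))) ∘
      transpose (cobang (ld_M N (inst be B)) ∘ eq_hom (ld_0 N) ∘ pi2)
  | t_allI _ D s A t => fun be ty Hty U HU =>
      let U' := nodup Nat.eq_dec (FV t) in
      sem_allI N (prodT (map ty U')) (asub A (flift s fid) (blift s be))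
        (fun r => Mcast (ld_M N) (inst_bcons be A r) ∘
           sem N t (bcons r be) ty (ty_wk D be r ty Hty) (incl_nodup (FV t)))
      ∘ ctx_restrict N ty (nodup_incl HU)
  | t_allE _ _ s A r t => fun be ty Hty U HU =>
      Mcast (ld_M N) (eq_sym (inst_open be A r)) ∘
      ld_proj N (asub A (flift s fid) (blift s be)) (tsub fid be r) ∘
      sem N t be ty Hty HU
  | t_exI _ _ s A r t => fun be ty Hty U HU =>
      ld_inj N (asub A (flift s fid) (blift s be)) (tsub fid be r) ∘
      Mcast (ld_M N) (inst_open be A r) ∘
      sem N t be ty Hty HU
  | t_exE _ D s A B t v => fun be ty Hty U HU =>
      let U' := nodup Nat.eq_dec (FV t ++ FV v) in
      sem_exE N (prodT (map ty U')) (asub A (flift s fid) (blift s be)) (inst be B)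
        (fun u => Mcast (ld_M N) (f_equal2 Arr (inst_bcons be A u) (inst_wk be B u)) ∘
           sem N v (bcons u be) ty (ty_wk D be u ty Hty)
             (fun i h => incl_nodup _ i (in_or_app _ _ i (or_intror h))))
      ∘ pairing (ctx_restrict N ty (nodup_incl HU))
          (sem N t be ty Hty (fun i h => HU i (in_or_app _ _ i (or_introl h))))
  end.

Lemma FV_bound {Sg : signature} {P : list (sort Sg)} {D : list (ltype Sg P)} {A}
    (t : tm Sg D A) : incl (FV t) (seq 0 (length D)).
Proof.
intros i. rewrite in_seq. revert i.
induction t; simpl; intros i0 Hi; repeat rewrite in_app_iff in Hi;
  try contradiction; try rewrite length_map in *; auto;
  try (now destruct Hi as [Hi|Hi]; auto); try (now destruct Hi as [Hi|[Hi|Hi]]; auto).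
- destruct Hi as [<-|[]]. lia.
- apply in_flat_map in Hi. destruct Hi as [[|j] [Hj H']]; [ destruct H' | ].
  destruct H' as [<-|[]]. apply IHt in Hj. simpl in Hj. lia.
Qed.

Lemma map_nth_seq {T : Type} (d : T) (l : list T) :
  l = map (fun i => nth i l d) (seq 0 (length l)).
Proof.
induction l as [|a l IH]; simpl; [ reflexivity | f_equal ].
rewrite <- seq_shift, map_map. exact IH.
Qed.

Definition interp {Sg : signature} (N : structure Sg) {D : list (LType Sg)} {A : LType Sg}
    (t : tm Sg D A) : hom (ld_M N (prodT D)) (ld_M N A) :=
  Mcast (ld_M N) (asub_id A) ∘
  sem N t bid (fun i => nth i D One) (fun i => eq_sym (asub_id (nth i D One)))
    (FV_bound t) ∘
  Mcast (ld_M N) (f_equal prodT (map_nth_seq One D)).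

Definition is_model {Sg : signature} (N : structure Sg) (T : theory Sg) : Prop :=
  forall e : equation Sg, T e -> interp N (eq_lhs e) = interp N (eq_rhs e).

Definition consequence_in {Sg : signature} (N : structure Sg) (Bs : list (LType Sg))
    (A : LType Sg) : Prop :=
  inhabited (hom (ld_M N (prodT Bs)) (ld_M N A)).

Definition logical_consequence {Sg : signature} (T : theory Sg) (Bs : list (LType Sg))
    (A : LType Sg) : Prop :=
  forall N : structure Sg, is_model N T -> consequence_in N Bs A.

(* Main.v *)
Require Import Defs.
From Stdlib Require Import List ProofIrrelevance ClassicalEpsilon.
Import ListNotations.

Set Implicit Arguments.

(** Being a logical consequence in a structure only asks for the existence of an arrow, so
    a proof need not be given its exact denotation, and a model in which parallel arrows
    are equal loses nothing.

    Soundness is an induction on proofs, each rule being matched by an operation on arrows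
    of a logically distributive category.  The universal arrow into [M (forall x. B)] needs
    a whole cone, one leg for every instance [B[t/x]]; a proof of the premise [B] must
    therefore be interpreted in all its substitution instances at once, and the induction
    is carried out for the image of the sequent under an arbitrary substitution
    ([soundness]).  The elimination of the existential uses in the same way a co-cone
    and the inverse of the Frobenius arrow.

    For completeness, a single structure suffices: the preorder of types under provability,
    [A <= B] when [proves [A] B], with the identity as the map on types
    ([lindenbaum_structure]).  Parallel arrows being equal, it is a model of every theory.
    Its universal properties are the introduction and elimination rules.  A cone over the
    instances of [A] with vertex [B], [x] not free in [B], has in particular a leg at the
    variable [x] itself, that is, a proof of [A] from [B], whence a proof of
    [forall x. A] from [B]; dually for the existential.  Composition of arrows is cut, which reduces to weakening; weakening
    has to rename the eigenvariables, so it is proved together with closure of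
    provability under substitution ([proves_asub]). *)

(** * Substitution under a binder *)

(** The environment [th] with [x] sent to [t].  Going through a bound variable instead of
    testing [y = x] makes substitution under [close x] an instance of [asub_asub]. *)
Definition override {L : vocabulary} {s : sort L} (th : fenv L []) (x : var s)
    (t : LTerm L s) : fenv L [] :=
  fun s' y => tsub th (bcons t bid) (fupd x (bvar s mO) s' y).

Definition body {L : vocabulary} {s : sort L} (th : fenv L []) (x : var s)
    (B : LType L) : ltype L [s] :=
  asub (close x B) (flift s th) (blift s bid).

Lemma open_body {L : vocabulary} {s : sort L} (th : fenv L []) (x : var s)
    (B : LType L) (t : LTerm L s) :
  open (body th x B) t = asub B (override th x t) bid.
Proof.
unfold body, open, inst, close. rewrite !asub_asub. apply asub_ext.
- intros s' m. destruct (mem_nil m).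
- intros s' y _. unfold override.
  apply tsub_ext.
  + apply bext; [ reflexivity | ]. intros s1 m. destruct (mem_nil m).
  + intros s1 z _. unfold flift. rewrite (proj1 (tsub_tsub _ _ _ _)).
    rewrite <- (proj1 tsub_id _ (th s1 z)) at 2. now apply tsub_ext.
Qed.

Lemma asub_subst {L : vocabulary} {s : sort L} (th : fenv L []) (x : var s)
    (B : LType L) (t : LTerm L s) :
  asub (subst x t B) th bid = open (body th x B) (tsub th bid t).
Proof.
rewrite <- open_close. unfold body, open, inst. rewrite !asub_asub. apply asub_ext.
- apply bext; [ reflexivity | ]. intros s' m. destruct (mem_nil m).
- intros s' y _. simpl. unfold flift. rewrite (proj1 (tsub_tsub _ _ _ _)).
  rewrite <- (proj1 tsub_id _ (th s' y)) at 1. now apply tsub_ext.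
Qed.

Lemma asub_override_fresh {L : vocabulary} {s : sort L} (th : fenv L []) (x : var s)
    (t : LTerm L s) (A : LType L) :
  ~ free x A -> asub A (override th x t) bid = asub A th bid.
Proof.
intros H. apply asub_ext; [ reflexivity | ]. intros s' y Hy. unfold override.
rewrite fupd_other; [ reflexivity | ].
intros e. injection e; intros -> ->. auto.
Qed.

Lemma map_asub_override_fresh {L : vocabulary} {s : sort L} (th : fenv L []) (x : var s)
    (t : LTerm L s) (G : list (LType L)) :
  (forall C, In C G -> ~ free x C) ->
  map (fun C => asub C (override th x t) bid) G = map (fun C => asub C th bid) G.
Proof. intros H. apply map_ext_in. intros C HC. now apply asub_override_fresh, H. Qed.

Lemma asub_closed {L : vocabulary} (th : fenv L []) (A : LType L) :
  (forall s (x : var s), ~ free x A) -> asub A th bid = A.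
Proof.
intros H. rewrite <- asub_id. apply asub_ext; [ reflexivity | ].
intros s x Hx. destruct (H s x Hx).
Qed.

Lemma asub_ax {Sg : signature} (th : fenv Sg []) (a : ax Sg) :
  asub (ax_src Sg a) th bid = ax_src Sg a /\ asub (ax_tgt Sg a) th bid = ax_tgt Sg a.
Proof.
split; apply asub_closed; intros s x H; apply (@ax_closed Sg a s x); simpl; auto.
Qed.

Lemma free_prodT {L : vocabulary} {s : sort L} (x : var s) (G : list (LType L)) C :
  In C G -> free x C -> free x (prodT G).
Proof.
induction G as [|A [|B G] IH]; intros H HC; [ destruct H | | ].
- destruct H as [->|[]]. exact HC.
- destruct H as [->|H]; [ now left | right; auto ].
Qed.

Lemma fresh_context {L : vocabulary} (s : sort L) (G : list (LType L)) (B : ltype L [s]) :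
  exists z : var s, (forall C, In C G -> ~ free z C) /\ ~ free z B.
Proof.
destruct (fresh_ex s (prodT G) B) as [z [HG HB]]. exists z. split; [ | exact HB ].
intros C HC H. exact (HG (free_prodT z G C HC H)).
Qed.

(** * Weakening and cut *)

Section Proofs.
Context {Sg : signature}.
Implicit Types (G : list (LType Sg)) (A B C : LType Sg).

Lemma proves_All_open G s (B : ltype Sg [s]) (t : LTerm Sg s) :
  proves Sg G (All B) -> proves Sg G (open B t).
Proof.
intros H. destruct (fresh_context G B) as [z [_ HB]].
rewrite <- (subst_open z B t HB). apply pr_allE.
unfold forallT. now rewrite close_open.
Qed.

Lemma proves_open_Ex G s (B : ltype Sg [s]) (t : LTerm Sg s) :
  proves Sg G (open B t) -> proves Sg G (Ex B).
Proof.
intros H. destruct (fresh_context G B) as [z [_ HB]].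
rewrite <- (close_open z B HB). apply pr_exI with t. now rewrite subst_open.
Qed.

(** An eigenvariable [x] may occur in [G'] or in the values of [th], so it is renamed to a
    fresh [z]: the induction hypothesis, being available for all substitutions, is used
    at [override th x z], which agrees with [th] on the types in which [x] is not free. *)
Lemma proves_asub G A : proves Sg G A ->
  forall (th : fenv Sg []) G', (forall C, In C G -> In (asub C th bid) G') ->
  proves Sg G' (asub A th bid).
Proof.
induction 1 as [ G A HA | G a | G B C _ IHB _ IHC | G A B _ IH | G A B _ IH
  | G B C _ IH | G B C _ IH | G A B C _ IH _ IHB _ IHC | G B C _ IH
  | G A B _ IHBA _ IHB | G | G B | G s x B HG _ IH | G s x B t _ IH | G s x B t _ IH
  | G s x A B HG HA _ IHE _ IH ]; intros th G' HG'; simpl in *.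
- apply pr_assum. auto.
- destruct (asub_ax th a) as [-> ->]. apply pr_ax.
- apply pr_andI; auto.
- eapply pr_andE1; auto.
- eapply pr_andE2; auto.
- apply pr_orI1; auto.
- apply pr_orI2; auto.
- eapply pr_orE; auto.
- apply pr_impI, IH. intros D [->|HD]; simpl; auto.
- eapply pr_impE; auto.
- apply pr_topI.
- apply pr_botE.
- change (proves Sg G' (All (body th x B))).
  destruct (fresh_context G' (body th x B)) as [z [Hz HB]].
  rewrite <- (close_open z _ HB). apply pr_allI; [ exact Hz | ].
  rewrite open_body. apply IH. intros C HC.
  rewrite asub_override_fresh; auto.
- rewrite asub_subst. apply proves_All_open. exact (IH th G' HG').
- specialize (IH th G' HG'). rewrite asub_subst in IH.
  exact (proves_open_Ex _ _ IH).
- destruct (fresh_context (asub A th bid :: G') (body th x B)) as [z [Hz HB]].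
  apply pr_exE with s z (open (body th x B) (fvar s z)).
  + intros C HC. apply Hz. now right.
  + apply Hz. now left.
  + unfold existsT. rewrite close_open by exact HB. exact (IHE th G' HG').
  + rewrite open_body, <- (asub_override_fresh th x (fvar s z) A HA).
    apply IH. intros C HC. rewrite asub_override_fresh; auto.
Qed.

Lemma proves_weaken G G' A : incl G G' -> proves Sg G A -> proves Sg G' A.
Proof.
intros H HA. rewrite <- (asub_id A). apply (proves_asub HA).
intros C HC. rewrite asub_id. auto.
Qed.

Lemma proves_cut G A B : proves Sg [A] B -> proves Sg G A -> proves Sg G B.
Proof.
intros HB HA. apply pr_impE with A; [ | exact HA ].
apply pr_impI, proves_weaken with [A]; [ | exact HB ].
intros C [->|[]]. now left.
Qed.

Lemma proves_hd G A : proves Sg (A :: G) A.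
Proof. apply pr_assum. now left. Qed.

Lemma proves_prodT G : proves Sg G (prodT G).
Proof.
induction G as [|A [|B G] IH].
- apply pr_topI.
- apply proves_hd.
- apply pr_andI; [ apply proves_hd | ].
  apply proves_weaken with (B :: G); [ | exact IH ]. now apply incl_tl, incl_refl.
Qed.

Lemma proves_impI1 A B G : proves Sg [A] B -> proves Sg G (Arr A B).
Proof. intros H. apply pr_impI, proves_cut with A; [ exact H | apply proves_hd ]. Qed.

Lemma proves_or_left A B C :
  proves Sg [A] C -> proves Sg [B] C -> proves Sg [Sum A B] C.
Proof.
intros HA HB. apply pr_orE with A B; [ apply proves_hd | | ]; now apply proves_impI1.
Qed.

Lemma proves_distr A B C :
  proves Sg [Prod A (Sum B C)] (Sum (Prod A B) (Prod A C)).
Proof.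
apply pr_orE with B C.
- eapply pr_andE2. apply proves_hd.
- apply pr_impI, pr_orI1, pr_andI; [ | apply proves_hd ].
  eapply pr_andE1, pr_assum. right. now left.
- apply pr_impI, pr_orI2, pr_andI; [ | apply proves_hd ].
  eapply pr_andE1, pr_assum. right. now left.
Qed.

Lemma proves_frobenius s (x : var s) A B : ~ free x A ->
  proves Sg [Prod A (existsT x B)] (existsT x (Prod A B)).
Proof.
intros HA. apply pr_exE with s x B.
- intros C [<-|[]] [H|H]; [ exact (HA H) | exact (not_free_close x B H) ].
- exact (not_free_close x (Prod A B)).
- eapply pr_andE2. apply proves_hd.
- apply pr_impI, pr_exI with (fvar s x). rewrite subst_id.
  apply pr_andI; [ | apply proves_hd ].
  eapply pr_andE1, pr_assum. right. now left.
Qed.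

(** The instance at [t = x] is the generic one, and gives the premise of [pr_allI]. *)
Lemma proves_forallT s (x : var s) A B : ~ free x B ->
  (forall t, proves Sg [B] (subst x t A)) -> proves Sg [B] (forallT x A).
Proof.
intros HB H. apply pr_allI.
- intros C [<-|[]]. exact HB.
- rewrite <- (subst_id x A). apply H.
Qed.

Lemma proves_existsT s (x : var s) A B : ~ free x B ->
  (forall t, proves Sg [subst x t A] B) -> proves Sg [existsT x A] B.
Proof.
intros HB H. apply pr_exE with s x A.
- intros C [<-|[]]. exact (not_free_close x A).
- exact HB.
- apply proves_hd.
- apply proves_impI1. rewrite <- (subst_id x A). apply H.
Qed.

End Proofs.

(** * The preorder of types under provability *)

Section Lindenbaum.
Variable Sg : signature.

Definition lindenbaum_cat : category.
Proof.
refine {| ob := LType Sg; hom := fun A B => proves Sg [A] B;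
  idm := fun A => proves_hd [] A;
  comp := fun X Y Z g f => proves_cut g f |}; intros; apply proof_irrelevance.
Defined.

(** Arrows are proofs of propositions, so proof irrelevance settles every equation
    between them. *)
Lemma lindenbaum_thin (X Y : lindenbaum_cat) (f g : hom X Y) : f = g.
Proof. exact (proof_irrelevance (proves Sg [X] Y) f g). Qed.

Definition lindenbaum_prod (A B : lindenbaum_cat) : product A B.
Proof.
refine (@Build_product lindenbaum_cat A B (Prod A B)
  (pr_andE1 (proves_hd [] (Prod A B))) (pr_andE2 (proves_hd [] (Prod A B)))
  (fun X => @pr_andI Sg [X] A B) _ _ _); intros; apply lindenbaum_thin.
Defined.

Definition lindenbaum_sum (A B : lindenbaum_cat) : coproduct A B.
Proof.
refine (@Build_coproduct lindenbaum_cat A B (Sum A B)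
  (pr_orI1 B (proves_hd [] A)) (pr_orI2 A (proves_hd [] B))
  (fun X => @proves_or_left Sg A B X) _ _ _); intros; apply lindenbaum_thin.
Defined.

Definition lindenbaum_exp (B A : lindenbaum_cat) : exponential lindenbaum_prod B A.
Proof.
unshelve refine (@Build_exponential lindenbaum_cat lindenbaum_prod B A
  (Arr A B) _ _ _ _).
- exact (pr_impE (pr_andE1 (proves_hd [] (Prod (Arr A B) A)))
    (pr_andE2 (proves_hd [] (Prod (Arr A B) A)))).
- intros X f. apply pr_impI. apply (proves_cut (A := Prod X A) f).
  apply pr_andI; [ apply pr_assum; right; now left | apply proves_hd ].
- intros; apply lindenbaum_thin.
- intros; apply lindenbaum_thin.
Defined.

Definition lindenbaum_bicartesian : bicartesian.
Proof.
refine {| bc_cat := lindenbaum_cat; bc_1 := One : lindenbaum_cat;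
  bc_0 := Zero : lindenbaum_cat; bc_prod := lindenbaum_prod;
  bc_sum := lindenbaum_sum; bc_exp := lindenbaum_exp |}.
- exists (fun X => pr_topI Sg [X]). intros; apply lindenbaum_thin.
- exists (fun X => pr_impE (pr_botE Sg [Zero] X) (proves_hd [] Zero)).
  intros; apply lindenbaum_thin.
Defined.

Definition lindenbaum_data : ld_data Sg.
Proof.
refine (@Build_ld_data Sg lindenbaum_bicartesian _ (fun A => A)
  eq_refl eq_refl (fun _ _ => eq_refl) (fun _ _ => eq_refl) (fun _ _ => eq_refl)
  (fun s B t => proves_All_open t (proves_hd [] (All B)))
  (fun s B t => proves_open_Ex B t (proves_hd [] (open B t))) _ _).
- intros A B D. exists (proves_distr A B D); apply lindenbaum_thin.
- intros s x A. unshelve econstructor.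
  + intros [[X p] HX]. simpl in *. unshelve eexists; [ unshelve eexists | ]; simpl.
    * destruct HX as [B [HB ->]]. now apply proves_forallT.
    * intros; apply lindenbaum_thin.
    * now right.
  + intros X f. apply sig_eq, sig_eq, lindenbaum_thin.
- intros s x A. unshelve econstructor.
  + intros [[X p] HX]. simpl in *. unshelve eexists; [ unshelve eexists | ]; simpl.
    * destruct HX as [B [HB ->]]. now apply proves_existsT.
    * intros; apply lindenbaum_thin.
    * now right.
  + intros X f. apply sig_eq, sig_eq, lindenbaum_thin.
Defined.

Definition lindenbaum_ld : ld_category Sg.
Proof.
exists lindenbaum_data. intros s x A B HA.
exists (proves_frobenius x A B HA); apply lindenbaum_thin.
Defined.

Definition lindenbaum_structure : structure Sg.
Proof.
exists lindenbaum_ld. intros a.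
exact (pr_impE (pr_ax Sg [ax_src Sg a] a) (proves_hd [] (ax_src Sg a))).
Defined.

Lemma lindenbaum_model (T : theory Sg) : is_model lindenbaum_structure T.
Proof. intros e _. apply lindenbaum_thin. Qed.

End Lindenbaum.

(** * Interpreting proofs by arrows *)

Section Soundness.
Context {Sg : signature} (N : structure Sg).

Lemma consequence_assum (G : list (LType Sg)) A : In A G -> consequence_in N G A.
Proof.
induction G as [|B G IH]; [ intros [] | ]. intros [->|H].
- exact (inhabits (ctx_head N A G)).
- destruct (IH H) as [f]. exact (inhabits (f ∘ ctx_tail N B G)).
Qed.

Lemma consequence_orE (G : list (LType Sg)) A B C :
  consequence_in N G (Sum A B) -> consequence_in N G (Arr A C) ->
  consequence_in N G (Arr B C) -> consequence_in N G C.
Proof.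
intros [t] [u] [v]. constructor.
exact (copairing (eval ∘ cross (eq_hom (ld_arr N A C) ∘ u) (idm _))
                 (eval ∘ cross (eq_hom (ld_arr N B C) ∘ v) (idm _))
       ∘ inv (ld_distr N _ _ _) ∘ pairing (idm _) (eq_hom (ld_sum N A B) ∘ t)).
Qed.

Lemma consequence_impI (G : list (LType Sg)) A B :
  consequence_in N (A :: G) B -> consequence_in N G (Arr A B).
Proof.
intros [f]. constructor.
exact (eq_hom (eq_sym (ld_arr N A B)) ∘ transpose (f ∘ ctx_cons N A G _ pi2 pi1)).
Qed.

Lemma consequence_impE (G : list (LType Sg)) A B :
  consequence_in N G (Arr A B) -> consequence_in N G A -> consequence_in N G B.
Proof.
intros [f] [g]. exact (inhabits (eval ∘ pairing (eq_hom (ld_arr N A B) ∘ f) g)).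
Qed.

(** The hypothesis gives each leg separately; the cone is assembled by choice. *)
Lemma consequence_All (G : list (LType Sg)) s (B : ltype Sg [s]) :
  (forall r, consequence_in N G (open B r)) -> consequence_in N G (All B).
Proof.
intros H. constructor. apply sem_allI. intros r.
exact (epsilon (H r) (fun _ => True)).
Qed.

Lemma consequence_Ex (G : list (LType Sg)) s (A : ltype Sg [s]) B :
  consequence_in N G (Ex A) ->
  (forall r, consequence_in N G (Arr (open A r) B)) -> consequence_in N G B.
Proof.
intros [t] H. constructor.
exact (sem_exE N (prodT G) A B (fun r => epsilon (H r) (fun _ => True))
       ∘ pairing (idm _) t).
Qed.

(** The substitution [th] is general so that, at a quantifier rule with eigenvariable [x],
    the induction hypothesis at [override th x r] gives the component at [r] of the cone
    or co-cone; the side condition on [x] keeps the context the same for all [r]. *)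
Lemma soundness (G : list (LType Sg)) A : proves Sg G A ->
  forall th : fenv Sg [],
  consequence_in N (map (fun C => asub C th bid) G) (asub A th bid).
Proof.
induction 1 as [ G A HA | G a | G B C _ IHB _ IHC | G A B _ IH | G A B _ IH
  | G B C _ IH | G B C _ IH | G A B C _ IH _ IHB _ IHC | G B C _ IH
  | G A B _ IHBA _ IHB | G | G B | G s x B HG _ IH | G s x B t _ IH | G s x B t _ IH
  | G s x A B HG HA _ IHE _ IH ]; intros th; simpl in *.
- apply consequence_assum. exact (in_map _ _ _ HA).
- destruct (asub_ax th a) as [-> ->]. apply consequence_impI. constructor.
  exact (st_ax N a ∘ ctx_head N _ _).
- destruct (IHB th) as [f], (IHC th) as [g]. constructor.
  exact (eq_hom (eq_sym (ld_prod N _ _)) ∘ pairing f g).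
- destruct (IH th) as [f]. exact (inhabits (pi1 ∘ eq_hom (ld_prod N _ _) ∘ f)).
- destruct (IH th) as [f]. exact (inhabits (pi2 ∘ eq_hom (ld_prod N _ _) ∘ f)).
- destruct (IH th) as [f]. exact (inhabits (eq_hom (eq_sym (ld_sum N _ _)) ∘ iota1 ∘ f)).
- destruct (IH th) as [f]. exact (inhabits (eq_hom (eq_sym (ld_sum N _ _)) ∘ iota2 ∘ f)).
- exact (consequence_orE (IH th) (IHB th) (IHC th)).
- apply consequence_impI, IH.
- exact (consequence_impE (IHBA th) (IHB th)).
- exact (inhabits (eq_hom (eq_sym (ld_1 N)) ∘ bang _)).
- apply consequence_impI. constructor.
  exact (cobang _ ∘ eq_hom (ld_0 N) ∘ ctx_head N Zero _).
- change (consequence_in N (map (fun C => asub C th bid) G) (All (body th x B))).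
  apply consequence_All. intros r.
  rewrite open_body, <- (map_asub_override_fresh th x r G HG). apply IH.
- rewrite asub_subst. destruct (IH th) as [f].
  exact (inhabits (ld_proj N (body th x B) (tsub th bid t) ∘ f)).
- specialize (IH th). rewrite asub_subst in IH. destruct IH as [f].
  exact (inhabits (ld_inj N (body th x B) (tsub th bid t) ∘ f)).
- apply (consequence_Ex (A := body th x B)); [ exact (IHE th) | ]. intros r.
  rewrite open_body, <- (map_asub_override_fresh th x r G HG),
    <- (asub_override_fresh th x r A HA). apply IH.
Qed.

End Soundness.

Theorem corollary6p17 (Sg : signature) (T : theory Sg) (A : LType Sg)
    (Bs : list (LType Sg)) :
  logical_consequence T Bs A <-> proves Sg Bs A.
Proof.
split.
- intros H. destruct (H (lindenbaum_structure Sg) (lindenbaum_model T)) as [f].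
  exact (proves_cut f (proves_prodT Bs)).
- intros H N _. pose proof (soundness N H fid) as S.
  rewrite (asub_id A), (map_ext _ id (fun C => asub_id C)), map_id in S. exact S.
Qed.
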